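(* Let $d\ge 1$. For each $\{T_I\}_{I\in\mathcal{D}}\in\mathcal{T}$, the linear functional $$\{S_I\}\mapsto\sum_{I\in\mathcal{D}}\operatorname{Tr}(S_IT_I^* )$$ is continuous on $\mathcal{S}$. Namely, there is a constant $c(d)$ depending only on $d$ (in particular not on $\{T_I\}$) such that for all $\{T_I\}\in\mathcal{T}$, $$\left|\sum_{I\in\mathcal{D}}\operatorname{Tr}(S_IT_I^* )\right|\le c(d)\,\|\{T_I\}\|_{\mathcal{T}}\,\|\{S_I\}\|_{\mathcal{S}}\qquad\text{for all }\{S_I\}\in\mathcal{S}.$$
   Context: $\mathcal{D}$ is the standard grid of dyadic intervals in $\mathbb{R}$; $|J|$ is the length of $J$, $1_I$ the indicator function of $I$, and $\|\cdot\|$ applied to a $d\times d$ complex matrix is its operator norm on $\mathbb{C}^d$. All sequences are sequences of $d\times d$ complex matrices indexed by $\mathcal{D}$; sums over $\mathcal{D}$ are unordered sums over a countable index set. For a sequence $\{S_I\}_{I\in\mathcal{D}}$ define the nonnegative function $S(x)=\left(\sum_{I\in\mathcal{D}}\|S_I\|^2\frac{1_I(x)}{|I|}\right)^{1/2}$. The space $\mathcal{S}$ consists of all sequences $\{S_I\}$ with $S\in L^1(\mathbb{R})$, and $\|\{S_I\}\|_{\mathcal{S}}=\|S\|_{L^1(\mathbb{R})}$. The space $\mathcal{T}$ consists of all sequences $\{T_I\}$ with $$\|\{T_I\}\|_{\mathcal{T}}^2=\sup_{J\in\mathcal{D}}\left\|\frac1{|J|}\sum_{I\in\mathcal{D},\,I\subseteq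 J}T_IT_I^*\right\|<\infty.$$ *)

(* Defs.v *)
From HB Require Import structures.
From mathcomp Require Import all_boot all_order all_algebra.
From mathcomp Require Import finmap complex.
From mathcomp Require Import all_classical all_reals all_analysis.
From mathcomp.analysis.showcase Require summability.

Set Implicit Arguments.
Unset Strict Implicit.
Unset Printing Implicit Defensive.

Import Order.TTheory GRing.Theory Num.Theory.
Import numFieldNormedType.Exports.

Local Open Scope classical_set_scope.
Local Open Scope complex_scope.
Local Open Scope sesquilinear_scope.
Local Open Scope ring_scope.

(* Unordered sums are limits of finite partial sums along the filter
   [summability.totally] of finite index sets ordered by inclusion. *)
Definition unordered_summable (I : choiceType) (K : numDomainType)
    (V : normedModType K) (x : I -> V) : Prop :=
  cvg (summability.partial_sum x @ summability.totally).

Definition unordered_sum (I : choiceType) (K : numDomainType)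
    (V : normedModType K) (x : I -> V) : V :=
  summability.sum x.

(* The index (k, m) stands for [m 2^k, (m+1) 2^k[; distinct indices give
   distinct intervals. *)
Definition dyadic : choiceType := (int * int)%type.

Section dyadic_intervals.
Variable R : realType.
Implicit Types I J : dyadic.

Definition dyadic_length I : R := 2 ^ I.1.

Definition dyadic_set I : set R :=
  [set` `[I.2%:~R * dyadic_length I, (I.2 + 1)%:~R * dyadic_length I[ ].

Definition dyadic_sub J : set dyadic :=
  [set I | dyadic_set I `<=` dyadic_set J].

End dyadic_intervals.
Arguments dyadic_length : clear implicits.
Arguments dyadic_set : clear implicits.
Arguments dyadic_sub : clear implicits.

Section matrix_sequences.
Variables (R : realType) (d : nat).
Local Notation C := R[i].
Local Notation mu := (@lebesgue_measure R).
Implicit Types (A : 'M[C]_d) (S T : dyadic -> 'M[C]_d).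

Definition cnorm2 (v : 'cV[C]_d) : R :=
  Num.sqrt (\sum_i (Normc.normc (v i 0)) ^+ 2).

(* The norm `|A| provided by MathComp-Analysis is the maximum modulus of the
   entries, hence this definition. *)
Definition opnorm A : R :=
  sup [set cnorm2 (A *m v) | v in [set v | cnorm2 v <= 1]].

Definition square_function S (x : R) : \bar R :=
  sqrte (\esum_(I in [set: dyadic])
    ((opnorm (S I)) ^+ 2 * (\1_(dyadic_set R I) x / dyadic_length R I))%:E).

Definition Sspace : set (dyadic -> 'M[C]_d) :=
  [set S | mu.-integrable [set: R] (square_function S)].

Definition Snorm S : \bar R := 'N[mu]_1[square_function S]%E.

Definition gram_restr T (J : dyadic) : dyadic -> 'M[C]_d :=
  patch (fun=> 0) (dyadic_sub R J) (fun I => T I *m (T I)^t*).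

Definition Tsqnorm T : \bar R :=
  ereal_sup [set (opnorm (((dyadic_length R J)^-1)%:C *:
                          unordered_sum (gram_restr T J)))%:E
            | J in [set: dyadic]].

(* [lim] is total, so existence of the sums has to be required separately. *)
Definition Tspace : set (dyadic -> 'M[C]_d) :=
  [set T | (forall J, unordered_summable (gram_restr T J)) /\
           (Tsqnorm T < +oo)%E].

Definition Tnorm T : \bar R := sqrte (Tsqnorm T).

Definition trace_terms T S : dyadic -> C^o := fun I => \tr (S I *m (T I)^t*).

Definition trace_functional T S : C := unordered_sum (trace_terms T S).

End matrix_sequences.

(* Main.v *)
(** Replace S_I by s_I = ||S_I|| and T_I by its Hilbert-Schmidt norm t_I, so that the
    hypothesis on T becomes the Carleson condition
    sum_(I <= J) t_I^2 <= d ||T||^2 |J|.  For a finite family F and K in F, let A_K be the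
    sum of s_L^2 / |L| over the L in F containing K, and D_K the increment of the square
    root of this sum at K.  Along the chain of intervals containing a point, the D_K
    telescope: hence sqrt A_I = sum_(K >= I) D_K, and sum_K D_K 1_K <= S pointwise, so that
    Q = sum_K D_K |K| <= ||S||_L1.  Since s_I^2 = |I| (A_I - A'_I) <= 2 |I| D_I sqrt A_I,
    AM-GM bounds s_I t_I by N |I| D_I + t_I^2 sqrt A_I / (2 N), and exchanging the order of
    summation in sum_I t_I^2 sum_(K >= I) D_K bounds the last term through the Carleson
    condition, giving sum_I s_I t_I <= 3/2 N Q. *)

Require Import Defs.
From HB Require Import structures.
From mathcomp Require Import all_boot all_order all_algebra.
From mathcomp Require Import finmap complex.
From mathcomp Require Import all_classical all_reals all_analysis.
From mathcomp Require Import measurable_realfun ring lra.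

Set Implicit Arguments.
Unset Strict Implicit.
Unset Printing Implicit Defensive.

Import Order.TTheory GRing.Theory Num.Theory.
Import numFieldNormedType.Exports.

Local Open Scope classical_set_scope.
Local Open Scope complex_scope.
Local Open Scope ring_scope.

(** * Telescoping sums along a chain *)

(** Once [r] is sorted by key, the two inner sums at [K] are the tail sums with and without [K], so
    neighbouring terms cancel. Later [key] is the level of a dyadic interval and [f] the square
    root. *)
Lemma sum_chain_telescope (V : zmodType) (T : eqType) (key : T -> int) (f : V -> V)
    (a : T -> V) (r : seq T) :
  {in r &, injective key} -> uniq r ->
  \sum_(K <- r) (f (\sum_(L <- r | (key K <= key L)%R) a L) -
                 f (\sum_(L <- r | (key K < key L)%R) a L)) =
  f (\sum_(L <- r) a L) - f 0.
Proof.
move: r.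
suff H : forall r, sorted (relpre key <%R) r ->
  \sum_(K <- r) (f (\sum_(L <- r | (key K <= key L)%R) a L) -
                 f (\sum_(L <- r | (key K < key L)%R) a L)) =
  f (\sum_(L <- r) a L) - f 0.
  move=> r kinj ur.
  have pr : perm_eq (sort (relpre key <=%R) r) r by rewrite perm_sort.
  rewrite -!(perm_big _ pr) /= -H; last first.
    rewrite -sorted_map lt_sorted_uniq_le sorted_map sort_sorted ?andbT; last first.
      by move=> x y; exact: le_total.
    rewrite map_inj_in_uniq ?(perm_uniq pr)// => x y.
    by rewrite !(perm_mem pr); exact: kinj.
  by apply: eq_bigr => K _; congr (f _ - f _); rewrite -(perm_big _ pr).
elim=> [|K r IH]; first by rewrite !big_nil subrr.
move=> /= pKr; rewrite big_cons.
have /allP Kr : all (fun L => key K < key L) r.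
  by have := order_path_min (fun (x y z : T) => @lt_trans _ _ (key x) (key y) (key z)) pKr.
rewrite !big_cons lexx ltxx.
(* For an element of the tail, the head [K] enters neither inner sum, its key being smaller. *)
rewrite (eq_big_seq (fun K0 =>
   (f (\sum_(L <- r | (key K0 <= key L)%R) a L) -
                 f (\sum_(L <- r | (key K0 < key L)%R) a L)))); last first.
  move=> L Lr; rewrite !big_cons leNgt (Kr _ Lr)/= ltNge.
  by rewrite (ltW (Kr _ Lr)).
rewrite IH ?(path_sorted pKr)//.
have e1 : \sum_(L <- r | key K <= key L) a L = \sum_(L <- r) a L.
  by rewrite [in LHS]big_seq_cond [in RHS]big_seq; apply: eq_bigl => L;
    case: (boolP (L \in r)) => //= /Kr/ltW ->.
have e2 : \sum_(L <- r | key K < key L) a L = \sum_(L <- r) a L.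
  by rewrite [in LHS]big_seq_cond [in RHS]big_seq; apply: eq_bigl => L;
    case: (boolP (L \in r)) => //= /Kr ->.
by rewrite e1 e2 addrA subrK.
Qed.

Lemma sumD1_seq_cond (V : nmodType) (T : eqType) (r : seq T) (j : T) (P : pred T)
    (F : T -> V) : j \in r -> P j -> uniq r ->
  \sum_(i <- r | P i) F i = F j + \sum_(i <- r | P i && (i != j)) F i.
Proof.
move=> jr Pj ur; rewrite -big_filter (bigD1_seq j) ?filter_uniq ?mem_filter ?Pj//=.
by rewrite big_filter_cond.
Qed.

(** * Nesting of dyadic intervals *)

Section dyadic_geometry.
Variable R : realType.
Implicit Types (I K L : dyadic) (x : R).

Lemma dyadic_length_gt0 I : 0 < dyadic_length R I.
Proof. by rewrite exprz_gt0. Qed.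

Lemma dyadic_setE I x : (x \in dyadic_set R I) =
  (I.2%:~R * dyadic_length R I <= x < (I.2 + 1)%:~R * dyadic_length R I).
Proof. by apply/idP/idP; rewrite inE /dyadic_set/= in_itv. Qed.

Lemma dyadic_set_nested K L x : x \in dyadic_set R K -> x \in dyadic_set R L ->
  K.1 <= L.1 -> dyadic_set R K `<=` dyadic_set R L.
Proof.
rewrite !dyadic_setE => /andP[Kx xK] /andP[Lx xL] KL y.
move=> /mem_set; rewrite dyadic_setE => /andP[Ky yK].
apply: set_mem; rewrite dyadic_setE.
have [n nE] : exists n : nat, L.1 = n%:Z + K.1.
  by exists `|L.1 - K.1|%N; rewrite gez0_abs ?subr_ge0// subrK.
have LE : dyadic_length R L = (2 ^+ n : int)%:~R * dyadic_length R K.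
  by rewrite /dyadic_length nE expfzDr ?pnatr_eq0// rmorphXn.
have K0 := dyadic_length_gt0 K.
(* All endpoints are now integer multiples of the length of [K], so the common point [x] gives
   strict inequalities between integers, which sharpen by one unit. *)
move: Lx xL; rewrite LE !mulrA -!intrM => Lx xL.
have := le_lt_trans Lx xK; have := le_lt_trans Kx xL.
rewrite !ltr_pM2r// !ltr_int !ltzD1 => h1 h2.
apply/andP; split.
  by apply: le_trans Ky; rewrite ler_pM2r// ler_int.
by apply: lt_le_trans yK _; rewrite ler_pM2r// ler_int lezD1.
Qed.

Lemma dyadic_set_level_inj K L x : x \in dyadic_set R K -> x \in dyadic_set R L ->
  K.1 = L.1 -> K = L.
Proof.
rewrite !dyadic_setE => /andP[Kx xK] /andP[Lx xL] KL.
have LE : dyadic_length R L = dyadic_length R K by rewrite /dyadic_length KL.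
have K0 := dyadic_length_gt0 K.
move: Lx xL; rewrite LE => Lx xL.
have := le_lt_trans Lx xK; have := le_lt_trans Kx xL.
rewrite !ltr_pM2r// !ltr_int !ltzD1 => h1 h2.
have E : K.2 = L.2 by apply/eqP; rewrite eq_le h1.
by rewrite [K]surjective_pairing [L]surjective_pairing KL E.
Qed.

Lemma mem_dyadic_left I : I.2%:~R * dyadic_length R I \in dyadic_set R I.
Proof. by rewrite dyadic_setE lexx ltr_pM2r ?dyadic_length_gt0// ltr_int ltzD1 lexx. Qed.

(** If [L] were shorter than [K], then [K] would contain two points at distance exactly the length
    of [L], and a half-open interval of that length cannot hold both. *)
Lemma dyadic_sub_level K L : K \in dyadic_sub R L -> K.1 <= L.1.
Proof.
rewrite inE => KL; rewrite leNgt; apply/negP => LK.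
have lLK : dyadic_length R L < dyadic_length R K.
  by rewrite /dyadic_length ltr_eXz2l// ltr1n.
have L0 := dyadic_length_gt0 L.
have /set_mem/KL/mem_set := mem_dyadic_left K; rewrite dyadic_setE => /andP[h1 _].
have : K.2%:~R * dyadic_length R K + dyadic_length R L \in dyadic_set R K.
  by rewrite dyadic_setE intrD mulrDl mul1r lerDl ltW//= ltrD2l.
move=> /set_mem/KL/mem_set; rewrite dyadic_setE intrD mulrDl mul1r ltrD2r => /andP[_].
by rewrite ltNge h1.
Qed.

(** Testing at one point of [K] turns the ancestors of [K] into a chain of intervals through [x],
    ordered by level. *)
Lemma dyadic_subE K L x : x \in dyadic_set R K ->
  (K \in dyadic_sub R L) = (K.1 <= L.1) && (x \in dyadic_set R L).
Proof.
move=> xK; apply/idP/andP => [KL|[KL xL]].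
  split; first exact: dyadic_sub_level.
  by move: KL xK; rewrite !inE => KL; exact: KL.
by rewrite inE; exact: dyadic_set_nested xK xL KL.
Qed.

End dyadic_geometry.

(** * Increments of the square root of the ancestor sums *)

Section stopping_weights.
Variables (R : realType) (F : seq dyadic) (a : dyadic -> R).
Hypotheses (F_uniq : uniq F) (a_ge0 : forall I, 0 <= a I).
Implicit Types (I K L : dyadic) (x : R).

(** This is A_K; the next two definitions are A'_K and D_K. *)
Definition ancestor_sum K : R := \sum_(L <- F | K \in dyadic_sub R L) a L.

Definition strict_ancestor_sum K : R :=
  \sum_(L <- F | (K \in dyadic_sub R L) && (L != K)) a L.

Definition sqrt_increment K : R :=
  Num.sqrt (ancestor_sum K) - Num.sqrt (strict_ancestor_sum K).

Lemma dyadic_sub_refl K : K \in dyadic_sub R K.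
Proof. by rewrite inE. Qed.

Lemma ancestor_sumE K : K \in F -> ancestor_sum K = a K + strict_ancestor_sum K.
Proof.
move=> KF; rewrite /ancestor_sum (sumD1_seq_cond _ KF)//=.
exact: dyadic_sub_refl.
Qed.

Lemma strict_ancestor_sum_ge0 K : 0 <= strict_ancestor_sum K.
Proof. exact: sumr_ge0. Qed.

Lemma ancestor_sum_ge0 K : 0 <= ancestor_sum K.
Proof. exact: sumr_ge0. Qed.

Lemma sqrt_increment_ge0 K : 0 <= sqrt_increment K.
Proof.
rewrite subr_ge0 ler_wsqrtr//.
rewrite /ancestor_sum (bigID (fun L => L != K))/= lerDl.
exact: sumr_ge0.
Qed.

(** The intervals of [F] through [x] with level in [p] form a chain. As [p] is closed upwards, the
    chain contains every ancestor in [F] of each of its members, so its tail sums are the ancestor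
    sums and the telescoping applies. *)
Lemma sum_sqrt_increment (p : pred int) x :
  (forall k l : int, k <= l -> p k -> p l) ->
  \sum_(K <- F | p K.1 && (x \in dyadic_set R K)) sqrt_increment K =
  Num.sqrt (\sum_(K <- F | p K.1 && (x \in dyadic_set R K)) a K).
Proof.
move=> p_up; rewrite -!(big_filter F).
set r := [seq K <- F | _].
have rP K : (K \in r) = [&& p K.1, x \in dyadic_set R K & K \in F].
  by rewrite mem_filter andbA.
have := @sum_chain_telescope _ _ fst Num.sqrt a r.
rewrite sqrtr0 subr0 => <-; last 2 first.
- by move=> K L; rewrite !rP => /and3P[_ xK _] /and3P[_ xL _]; exact: (dyadic_set_level_inj xK xL).
- exact: filter_uniq.
apply: eq_big_seq => K; rewrite rP => /and3P[pK xK KF].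
rewrite /sqrt_increment; congr (Num.sqrt _ - Num.sqrt _).
  rewrite /ancestor_sum /r big_filter_cond; apply: eq_bigl => L.
  rewrite (dyadic_subE _ xK); case: (leP K.1 L.1) => [KL|]; rewrite ?andbF//=.
  by rewrite (p_up _ _ KL pK) andbT.
rewrite /strict_ancestor_sum /r big_filter_cond; apply: eq_bigl => L.
(* Among intervals through [x], a different interval means a different level, which matches [L != K]
   with the strict order of levels. *)
rewrite (dyadic_subE _ xK) lt_neqAle; case: (leP K.1 L.1) => [KL|]; rewrite ?andbF//=.
rewrite (p_up _ _ KL pK) andbT/=; case: (boolP (x \in _)) => //= xL.
congr negb; apply/eqP/eqP => [->//|KL'].
exact/esym/(dyadic_set_level_inj xK xL).
Qed.

(** The chain is taken through the left endpoint of [I], from the level of [I] upwards. *)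
Lemma sum_sqrt_increment_ancestors I :
  \sum_(K <- F | I \in dyadic_sub R K) sqrt_increment K = Num.sqrt (ancestor_sum I).
Proof.
have xI := mem_dyadic_left R I.
rewrite /ancestor_sum; under eq_bigl do rewrite (dyadic_subE _ xI).
under [in RHS]eq_bigl do rewrite (dyadic_subE _ xI).
by apply: (@sum_sqrt_increment (fun k => I.1 <= k)) => k l kl /le_trans; exact.
Qed.

Lemma sum_sqrt_increment_point x :
  \sum_(K <- F) sqrt_increment K * \1_(dyadic_set R K) x =
  Num.sqrt (\sum_(K <- F) a K * \1_(dyadic_set R K) x).
Proof.
under eq_bigr do rewrite indicE mulr_natr mulrb.
under [in RHS]eq_bigr do rewrite indicE mulr_natr mulrb.
by rewrite -!big_mkcond; exact: (@sum_sqrt_increment xpredT).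
Qed.

(** With A and A' the two ancestor sums, a = A - A' factors as (sqrt A - sqrt A') (sqrt A + sqrt
    A'), and A' <= A. *)
Lemma le_sqrt_increment K : K \in F ->
  a K <= 2 * Num.sqrt (ancestor_sum K) * sqrt_increment K.
Proof.
move=> KF; rewrite /sqrt_increment.
have -> : a K = ancestor_sum K - strict_ancestor_sum K by rewrite (ancestor_sumE KF) addrK.
have /ler_wsqrtr : strict_ancestor_sum K <= ancestor_sum K.
  by rewrite (ancestor_sumE KF) lerDr.
rewrite -[X in X - _ <= _](sqr_sqrtr (ancestor_sum_ge0 K)).
rewrite -[X in _ - X <= _](sqr_sqrtr (strict_ancestor_sum_ge0 K)).
have := sqrtr_ge0 (ancestor_sum K); have := sqrtr_ge0 (strict_ancestor_sum K).
by nra.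
Qed.

End stopping_weights.

(** * The scalar duality inequality for finite families *)

(** The sum on the right does not involve [t]; it is later bounded by the L1 norm of the square
    function. *)
Lemma scalar_duality (R : realType) (F : seq dyadic) (s t : dyadic -> R) (N : R) :
  let a I := s I ^+ 2 / dyadic_length R I in
  uniq F -> (forall I, 0 <= s I) -> 0 <= N ->
  (forall J, \sum_(I <- F | I \in dyadic_sub R J) t I ^+ 2 <= N ^+ 2 * dyadic_length R J) ->
  \sum_(I <- F) s I * t I <=
  3 / 2 * N * \sum_(I <- F) sqrt_increment F a I * dyadic_length R I.
Proof.
move=> a Fu s0 N0 carl.
have a0 I : 0 <= a I by rewrite divr_ge0 ?sqr_ge0// ltW// dyadic_length_gt0.
set D := sqrt_increment F a.
have D0 I : 0 <= D I by exact: sqrt_increment_ge0.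
have l0 I := dyadic_length_gt0 R I.
move: N0; rewrite le_eqVlt => /predU1P[N0|N0].
  (* When N = 0, the Carleson condition at J = I forces t_I = 0. *)
  rewrite -N0 mulr0 mul0r big_seq big1// => I IF.
  have := carl I; rewrite -N0 expr0n mul0r (sumD1_seq_cond _ IF)//=; last exact: dyadic_sub_refl.
  have : 0 <= \sum_(L <- F | (L \in dyadic_sub R I) && (L != I)) t L ^+ 2.
    by apply: sumr_ge0 => L _; exact: sqr_ge0.
  have := sqr_ge0 (t I) => h1 h2 h3.
  have /eqP : t I ^+ 2 = 0 by lra.
  by rewrite sqrf_eq0 => /eqP ->; rewrite mulr0.
(* The AM-GM bound, multiplied by 2 N to avoid quotients. *)
have key I : I \in F -> 2 * N * (s I * t I) <=
    2 * N ^+ 2 * (D I * dyadic_length R I) + t I ^+ 2 * Num.sqrt (ancestor_sum F a I).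
  move=> IF; have aI := le_sqrt_increment Fu a0 IF.
  have := sqrtr_ge0 (ancestor_sum F a I).
  set w := Num.sqrt _ in aI *; rewrite -/D in aI.
  have sI : s I ^+ 2 = a I * dyadic_length R I by rewrite /a divfK// gt_eqF.
  rewrite le_eqVlt => /predU1P[w0|w0].
    have /eqP : s I ^+ 2 = 0.
      move: aI; rewrite sI -w0 mulr0 mul0r => aI.
      by rewrite (_ : a I = 0) ?mul0r//; apply: le_anti; rewrite aI a0.
    rewrite sqrf_eq0 => /eqP ->.
    by rewrite mul0r mulr0 -w0 mulr0 addr0 mulr_ge0// ?mulr_ge0// ltW.
  (* Multiplied by [w], the claim follows from 2 N s t w <= N^2 s^2 + t^2 w^2, where [aI] controls
     N^2 s^2. *)
  rewrite -(ler_pM2r w0).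
  have h : N ^+ 2 * s I ^+ 2 <= 2 * N ^+ 2 * (D I * dyadic_length R I) * w.
    rewrite sI (_ : 2 * _ * _ * w = N ^+ 2 * (2 * w * D I * dyadic_length R I)); last by ring.
    by rewrite ler_wpM2l ?sqr_ge0// ler_wpM2r// ltW.
  have := sqr_ge0 (N * s I - t I * w).
  by rewrite mulrDl sqrrB !exprMn; lra.
(* Expanding the root as a sum of D_K over the ancestors K of I and exchanging sums leaves, for each
   K, the sum of t_I^2 over I inside K: the Carleson condition applies. *)
have t2w : \sum_(I <- F) t I ^+ 2 * Num.sqrt (ancestor_sum F a I) <=
    N ^+ 2 * \sum_(I <- F) D I * dyadic_length R I.
  under eq_bigr do rewrite -(sum_sqrt_increment_ancestors a Fu) mulr_sumr.
  rewrite (exchange_big_dep xpredT)//= mulr_sumr ler_sum// => K _.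
  rewrite -mulr_suml mulrC mulrCA; exact: ler_wpM2l.
have : 2 * N * \sum_(I <- F) s I * t I <=
   2 * N ^+ 2 * (\sum_(I <- F) D I * dyadic_length R I)
   + N ^+ 2 * (\sum_(I <- F) D I * dyadic_length R I).
  apply: le_trans (lerD (lexx _) t2w).
  by rewrite !mulr_sumr -big_split/= big_seq [leRHS]big_seq ler_sum.
(* The two contributions add up to 3 N^2 Q; division by 2 N gives the constant 3/2. *)
move=> h; rewrite -(@ler_pM2l _ (2 * N)); last by lra.
by apply: le_trans h _; rewrite -subr_ge0 (_ : _ - _ = 0)//; field.
Qed.

(** * Comparison of the operator norm with the entries *)

Section operator_norm_facts.
Variables (R : realType) (d : nat).
Implicit Types (A B : 'M[R[i]]_d) (v : 'cV[R[i]]_d).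
Local Notation normc := (@Normc.normc R).

Lemma normc_ge0 (z : R[i]) : 0 <= normc z.
Proof. by case: z => x y; exact: sqrtr_ge0. Qed.

Lemma normc_sum_le (I : Type) (r : seq I) (P : pred I) (F : I -> R[i]) :
  normc (\sum_(k <- r | P k) F k) <= \sum_(k <- r | P k) normc (F k).
Proof.
elim/big_rec2 : _ => [|k y z _ h]; first by rewrite Normc.normc0.
by apply: le_trans (le_normcD _ _) _; rewrite lerD2l.
Qed.

Lemma le_cnorm2 v k : normc (v k 0) <= cnorm2 v.
Proof.
rewrite -[leLHS](ger0_norm (normc_ge0 _)) -sqrtr_sqr ler_wsqrtr//.
rewrite (bigD1 k)//= lerDl; apply: sumr_ge0 => l _; exact: sqr_ge0.
Qed.

Lemma cnorm2_le_sum v : cnorm2 v <= \sum_k normc (v k 0).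
Proof.
have s0 : 0 <= \sum_k normc (v k 0) by apply: sumr_ge0 => k _; exact: normc_ge0.
rewrite -[leRHS](ger0_norm s0) -sqrtr_sqr ler_wsqrtr//.
rewrite [leRHS]expr2 mulr_sumr; apply: ler_sum => k _; rewrite expr2.
apply: ler_wpM2r; first exact: normc_ge0.
by rewrite (bigD1 k)//= lerDl; apply: sumr_ge0 => l _; exact: normc_ge0.
Qed.

Lemma cnorm2_mulmx_le A v : cnorm2 v <= 1 ->
  cnorm2 (A *m v) <= \sum_k \sum_l normc (A k l).
Proof.
move=> v1; apply: le_trans (cnorm2_le_sum _) _; apply: ler_sum => k _.
rewrite mxE; apply: le_trans (normc_sum_le _ _ _) _; apply: ler_sum => l _.
rewrite Normc.normcM ler_piMr ?normc_ge0//.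
exact: le_trans (le_cnorm2 _ _) v1.
Qed.

(** [sup] is meaningful only on a nonempty bounded set; every later estimate of [opnorm] rests on
    this. *)
Lemma opnorm_has_sup A :
  has_sup [set cnorm2 (A *m v) | v in [set v | cnorm2 v <= 1]].
Proof.
split; last by exists (\sum_k \sum_l normc (A k l)) => _ [v v1 <-]; exact: cnorm2_mulmx_le.
exists (cnorm2 (A *m 0)), 0 => //=.
by apply: le_trans (cnorm2_le_sum _) _; rewrite big1// => k _; rewrite mxE Normc.normc0.
Qed.

Lemma opnorm_le_sum A : opnorm A <= \sum_k \sum_l normc (A k l).
Proof.
apply: sup_le_ub; first exact: (opnorm_has_sup A).1.
by move=> _ [v v1 <-]; exact: cnorm2_mulmx_le.
Qed.

Lemma le_opnorm A k l : normc (A k l) <= opnorm A.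
Proof.
apply: (@le_trans _ _ (cnorm2 (A *m delta_mx l 0))).
  by rewrite -colE; apply: le_trans (le_cnorm2 _ k); rewrite mxE.
apply: ub_le_sup; first exact: (opnorm_has_sup A).2.
exists (delta_mx l 0) => //=.
apply: le_trans (cnorm2_le_sum _) _.
rewrite (bigD1 l)//= mxE !eqxx mulr1n Normc.normc1 big1 ?addr0// => m ml.
by rewrite mxE (negPf ml) mulr0n Normc.normc0.
Qed.

Lemma opnorm_ge0 A : 0 <= opnorm A.
Proof.
apply: (@le_trans _ _ (cnorm2 (A *m 0))); first exact: sqrtr_ge0.
apply: ub_le_sup; first exact: (opnorm_has_sup A).2.
exists 0 => //=.
by apply: le_trans (cnorm2_le_sum _) _; rewrite big1// => k _; rewrite mxE Normc.normc0.
Qed.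

(** Each of the d^2 entries is bounded separately. The loss is harmless, since this only serves to
    show that [Sspace] is stable under linear combinations. *)
Lemma opnormZD_le (c : R[i]) A B :
  opnorm (c *: A + B) <= d%:R ^+ 2 * (normc c * opnorm A + opnorm B).
Proof.
apply: le_trans (opnorm_le_sum _) _.
rewrite expr2 -mulrA -[X in _ <= X%:R * _](card_ord d) mulr_natl -sumr_const.
apply: ler_sum => k _.
rewrite -[X in _ <= X%:R * _](card_ord d) mulr_natl -sumr_const.
apply: ler_sum => l _; rewrite !mxE.
apply: le_trans (le_normcD _ _) _; rewrite lerD ?le_opnorm//.
by rewrite Normc.normcM ler_wpM2l ?normc_ge0// le_opnorm.
Qed.

(** The trace is a sum of d^2 products of entries, the source of the factor d^2 in the final
    constant. *)
Lemma normc_trace_le A B (b : R) : (forall k l, normc (B k l) <= b) ->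
  normc (\tr (A *m B)) <= d%:R ^+ 2 * (opnorm A * b).
Proof.
move=> Bb; apply: le_trans (normc_sum_le _ _ _) _.
rewrite expr2 -mulrA -[X in _ <= X%:R * _](card_ord d) mulr_natl -sumr_const.
apply: ler_sum => k _; rewrite mxE; apply: le_trans (normc_sum_le _ _ _) _.
rewrite -[X in _ <= X%:R * _](card_ord d) mulr_natl -sumr_const.
apply: ler_sum => l _; rewrite Normc.normcM.
by rewrite ler_pM ?normc_ge0 ?le_opnorm.
Qed.

End operator_norm_facts.

(** * The square function and its integral *)

(** Codes of no element contribute 0. The series over the naturals gives access to measurability of
    countable sums. *)
Lemma esum_pickle_inv (R : realType) (T : countType) (f : T -> \bar R) :
  (forall i, (0 <= f i)%E) ->
  (\esum_(i in [set: T]) f i = \sum_(0 <= n <oo) oapp f 0%E (pickle_inv n))%E.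
Proof.
move=> f0; rewrite nneseries_esumT; last by move=> n; case: pickle_inv => /=.
transitivity (\esum_(n in range (@choice.pickle T)) oapp f 0%E (pickle_inv n)).
  rewrite (@reindex_esum R T nat [set: T] (range (@choice.pickle T)) choice.pickle).
    by apply: eq_esum => i _; rewrite pickleK_inv.
  by apply: inj_bij => x y _ _; exact: (pcan_inj choice.pickleK_inv).
rewrite esum_mkcond; apply: eq_esum => n _; case: ifPn => // /negP nr.
have := pickle_invK (T := T) n; case: pickle_inv => [x|]//= xn; case: nr.
by rewrite inE; exists x.
Qed.

Section square_function_facts.
Variables (R : realType) (d : nat).
Implicit Types S : dyadic -> 'M[R[i]]_d.
Local Notation mu := (@lebesgue_measure R).

Lemma square_term_ge0 S I x :
  0 <= opnorm (S I) ^+ 2 * (\1_(dyadic_set R I) x / dyadic_length R I).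
Proof.
by rewrite mulr_ge0 ?sqr_ge0// divr_ge0// ltW// dyadic_length_gt0.
Qed.

Lemma square_function_ge0 S x : (0 <= square_function S x)%E.
Proof. exact: sqrte_ge0. Qed.

Lemma measurable_dyadic_set (I : dyadic) : measurable (dyadic_set R I).
Proof. exact: measurable_itv. Qed.

Lemma measurable_dyadic_indic (I : dyadic) :
  measurable_fun [set: R] (fun x => (\1_(dyadic_set R I) x : R)%:E).
Proof. by apply/measurable_EFinP; apply: measurable_indic; exact: measurable_dyadic_set. Qed.

Lemma lebesgue_dyadic_set (I : dyadic) : mu (dyadic_set R I) = (dyadic_length R I)%:E.
Proof.
rewrite lebesgue_measure_itv/= lte_fin ltr_pM2r ?dyadic_length_gt0// ltr_int ltzD1 lexx.
by rewrite -EFinB intrD mulrDl mul1r addrC addKr.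
Qed.

Lemma le_sum_square_function S (F : seq dyadic) x : uniq F ->
  ((Num.sqrt (\sum_(K <- F) opnorm (S K) ^+ 2 / dyadic_length R K
       * \1_(dyadic_set R K) x))%:E <= square_function S x)%E.
Proof.
move=> Fu.
have e0 : (0 <= \esum_(I in [set: dyadic])
    ((opnorm (S I)) ^+ 2 * (\1_(dyadic_set R I) x / dyadic_length R I))%:E)%E.
  by apply: esum_ge0 => I _; rewrite lee_fin square_term_ge0.
rewrite /square_function -[leLHS]/(sqrte (_ %:E)) lee_sqrt//.
apply: esum_ge; exists [set` F]; first by split.
rewrite -fsbig_seq//= sumEFin lee_fin.
by apply: ler_sum => K _; rewrite mulrAC mulrA.
Qed.

(** Integrating the pointwise bound turns each indicator into the length of its interval. *)
Lemma le_sum_Snorm S (F : seq dyadic) (c : dyadic -> R) :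
  measurable_fun [set: R] (square_function S) -> (forall I, 0 <= c I) ->
  (forall x, (\sum_(K <- F) c K * \1_(dyadic_set R K) x)%:E <= square_function S x)%E ->
  ((\sum_(K <- F) c K * dyadic_length R K)%:E <= Snorm S)%E.
Proof.
move=> mS c0 cS; rewrite /Snorm Lnorm1.
apply: (@le_trans _ _ (\int[mu]_x (\sum_(K <- F) (c K * \1_(dyadic_set R K) x)%:E))%E).
  rewrite ge0_integral_sum//=; last 2 first.
  - move=> K; under eq_fun do rewrite EFinM.
    by apply: measurable_funeM; exact: measurable_dyadic_indic.
  - by move=> K x _; rewrite lee_fin mulr_ge0.
  rewrite -sumEFin; apply: lee_sum => K _.
  under eq_integral do rewrite EFinM.
  rewrite ge0_integralZl//=; last 2 first.
  - exact: measurable_dyadic_indic.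
  - by rewrite lee_fin.
  rewrite integral_indic//; last exact: measurable_dyadic_set.
  by rewrite setIT [X in (_ * X)%E]lebesgue_dyadic_set.
apply: ge0_le_integral => //=.
- by move=> x _; apply: sume_ge0 => K _; rewrite lee_fin mulr_ge0.
- apply: emeasurable_sum => K; under eq_fun do rewrite EFinM.
  by apply: measurable_funeM; exact: measurable_dyadic_indic.
- exact: measurableT_comp.
- by move=> x _; rewrite sumEFin gee0_abs ?square_function_ge0.
Qed.

(** By telescoping, the sum of D_K 1_K at a point is the square function truncated to [F]. This is
    the bound on Q. *)
Lemma sum_sqrt_increment_Snorm S (F : seq dyadic) :
  uniq F -> measurable_fun [set: R] (square_function S) ->
  ((\sum_(K <- F) sqrt_increment F (fun I => opnorm (S I) ^+ 2 / dyadic_length R I) K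
       * dyadic_length R K)%:E <= Snorm S)%E.
Proof.
move=> Fu mS; apply: le_sum_Snorm => // [I|x].
  apply: sqrt_increment_ge0 => K.
  by rewrite divr_ge0 ?sqr_ge0// ltW// dyadic_length_gt0.
by rewrite sum_sqrt_increment_point//; exact: le_sum_square_function.
Qed.

End square_function_facts.

(** * Stability of [Sspace] under linear combinations *)

(** Uses n p + q <= (n + 1) (p + q) and (p + q)^2 <= 4 (p^2 + q^2); the 4 keeps the constant a
    perfect square, whose root is taken afterwards. *)
Lemma sqr_combination_le (R : realDomainType) (m n p q o : R) :
  0 <= m -> 0 <= n -> 0 <= p -> 0 <= q -> 0 <= o -> o <= m * (n * p + q) ->
  o ^+ 2 <= (2 * m * (n + 1)) ^+ 2 * (p ^+ 2 + q ^+ 2).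
Proof.
move=> m0 n0 p0 q0 o0 h.
have {h}h : o <= m * (n + 1) * (p + q).
  apply: le_trans h _; rewrite -mulrA ler_wpM2l//.
  by have := mulr_ge0 n0 q0; lra.
apply: (@le_trans _ _ ((m * (n + 1) * (p + q)) ^+ 2)).
  by rewrite ler_pXn2r ?nnegrE// !mulr_ge0 ?addr_ge0.
rewrite -subr_ge0.
have -> : (2 * m * (n + 1)) ^+ 2 * (p ^+ 2 + q ^+ 2) - (m * (n + 1) * (p + q)) ^+ 2 =
  (m * (n + 1)) ^+ 2 * (2 * (p ^+ 2 + q ^+ 2) + (p - q) ^+ 2) by ring.
by rewrite mulr_ge0 ?sqr_ge0// addr_ge0 ?sqr_ge0// mulr_ge0// addr_ge0 ?sqr_ge0.
Qed.

Lemma le_esum_scaleD (R : realType) (T : choiceType) (k : R) (f g h : T -> R) :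
  0 <= k -> (forall i, f i <= k * (g i + h i)) ->
  (\esum_(i in [set: T]) (f i)%:E <=
   k%:E * (\esum_(i in [set: T]) (g i)%:E + \esum_(i in [set: T]) (h i)%:E))%E.
Proof.
move=> k0 fgh; apply: ge_ereal_sup => _ [X [finX _] <-].
apply: (@le_trans _ _ (k%:E * (\sum_(i \in X) (g i)%:E + \sum_(i \in X) (h i)%:E))%E); last first.
  apply: lee_wpmul2l; first by rewrite lee_fin.
  by apply: leeD; apply: esum_ge; exists X.
rewrite 3?fsbig_finite//.
rewrite 3?sumEFin -EFinD -EFinM lee_fin -big_split mulr_sumr.
by apply: ler_sum => i _; exact: fgh.
Qed.

Section Sspace_closure.
Variables (R : realType) (d : nat).
Implicit Types S : dyadic -> 'M[R[i]]_d.
Local Notation mu := (@lebesgue_measure R).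

(** A countable series of nonnegative measurable terms is measurable, and the root is rewritten as
    the power 1/2, a measurable map. *)
Lemma measurable_square_function S : measurable_fun [set: R] (square_function S).
Proof.
have term0 x (I : dyadic) : (0 <= (opnorm (S I) ^+ 2 *
    (\1_(dyadic_set R I) x / dyadic_length R I))%:E)%E.
  by rewrite lee_fin; exact: square_term_ge0.
rewrite (_ : square_function S = fun x => ((\sum_(0 <= n <oo)
    oapp (fun I : dyadic => (opnorm (S I) ^+ 2 *
      (\1_(dyadic_set R I) x / dyadic_length R I))%:E) 0
    (@pickle_inv (int * int)%type n)) `^ 2^-1)%E); last first.
  apply/funext => x; rewrite -(@esum_pickle_inv _ (int * int)%type)//.
  by rewrite poweR12_sqrt//; exact: esum_ge0.
apply: (measurableT_comp (measurable_poweR 2^-1)).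
apply: (@ge0_emeasurable_sum _ _ _ _ _ xpredT) => n.
  by move=> x _ _; case: pickle_inv => /=.
move=> _; case: pickle_inv => [I|]/=; last exact: measurable_cst.
under eq_fun do rewrite mulrCA mulrC EFinM.
by apply: measurable_funeM; exact: measurable_dyadic_indic.
Qed.

Lemma sqrteD_le (u v : \bar R) : (0 <= u)%E -> (0 <= v)%E ->
  (sqrte (u + v) <= sqrte u + sqrte v)%E.
Proof.
case: u => [u| |]; case: v => [v| |]//=; rewrite ?leey// !lee_fin => u0 v0.
rewrite -ler_sqr ?nnegrE ?addr_ge0 ?sqrtr_ge0// sqrrD !sqr_sqrtr ?addr_ge0//.
by rewrite addrAC lerDl mulrn_wge0// mulr_ge0 ?sqrtr_ge0.
Qed.

(** The squared bound holds term by term, passes to the sum, and then to the root by subadditivity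
    of the square root. *)
Lemma square_functionZD_le (a : R[i]) S1 S2 : exists2 c : R, 0 <= c &
  forall x, (square_function (fun I => a *: S1 I + S2 I)%R x <=
    c%:E * (square_function S1 x + square_function S2 x))%E.
Proof.
set c := 2 * d%:R ^+ 2 * (Normc.normc a + 1).
have c0 : 0 <= c.
  by rewrite /c mulr_ge0// ?addr_ge0 ?normc_ge0// mulr_ge0// exprn_ge0//.
exists c => // x.
set f := fun S (I : dyadic) =>
  opnorm (S I) ^+ 2 * (\1_(dyadic_set R I) x / dyadic_length R I).
have f0 S I : (0 <= (f S I)%:E)%E by rewrite lee_fin; exact: square_term_ge0.
have e0 S : (0 <= \esum_(I in [set: dyadic]) (f S I)%:E)%E by exact: esum_ge0.
have sqE S : square_function S x = sqrte (\esum_(I in [set: dyadic]) (f S I)%:E)%E by [].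
have fle I : f (fun J => a *: S1 J + S2 J) I <= c ^+ 2 * (f S1 I + f S2 I).
  rewrite /f -mulrDl [leRHS]mulrA; apply: ler_wpM2r.
    by rewrite divr_ge0// ltW// dyadic_length_gt0.
  apply: sqr_combination_le; rewrite ?opnorm_ge0 ?normc_ge0 ?exprn_ge0//.
  exact: opnormZD_le.
have ele := le_esum_scaleD (sqr_ge0 c) fle.
rewrite !sqE; apply: le_trans (_ : (sqrte ((c ^+ 2)%:E * (\esum_(I in [set: dyadic]) (f S1 I)%:E
   + \esum_(I in [set: dyadic]) (f S2 I)%:E)) <= _)%E).
  by rewrite lee_sqrt// mule_ge0 ?adde_ge0// lee_fin sqr_ge0.
rewrite sqrteM ?lee_fin ?sqr_ge0//= sqrtr_sqr ger0_norm//.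
by apply: lee_wpmul2l; rewrite ?lee_fin// sqrteD_le.
Qed.

Lemma SspaceZD (a : R[i]) S1 S2 : Sspace S1 -> Sspace S2 ->
  Sspace (fun I => a *: S1 I + S2 I).
Proof.
move=> i1 i2; have [c c0 h] := square_functionZD_le a S1 S2.
apply: (@le_integrable _ _ _ mu _ _ _
  (fun x => c%:E * (square_function S1 x + square_function S2 x))%E) => //.
- exact: measurable_square_function.
- move=> x _; rewrite gee0_abs ?square_function_ge0//; apply: le_trans (h x) _.
  by rewrite lee_abs.
- apply: (@integrableZl _ _ _ mu _ _ c) => //.
  exact: (@integrableD _ _ _ mu _ _ _ _ i1 i2).
Qed.

Lemma Snorm_fin_num S : Sspace S -> Snorm S \is a fin_num.
Proof.
move=> /integrableP[mS iS]; rewrite /Snorm Lnorm1 ge0_fin_numE//.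
exact: integral_ge0.
Qed.

End Sspace_closure.

(* Unordered sums of complex numbers *)
Local Existing Instance summability.totally_filter.

Lemma ler_sum_fset (R : numDomainType) (I : choiceType) (h : I -> R) (A B : {fset I}) :
  (forall i, 0 <= h i) -> (A `<=` B)%fset -> \sum_(i <- A) h i <= \sum_(i <- B) h i.
Proof.
move=> h0 AB.
have pA : perm_eq [seq i <- B | i \in A] A.
  apply: uniq_perm; rewrite ?filter_uniq// => i; rewrite mem_filter.
  by case: (boolP (i \in A)) => //= /(fsubsetP AB) ->.
rewrite [leRHS](bigID (mem A))/= -[X in _ <= X + _]big_filter (perm_big _ pA)/=.
by rewrite lerDl sumr_ge0.
Qed.

Section complex_unordered_sums.
Variables (R : realType) (I : choiceType).
Implicit Types (x : I -> R[i]^o) (l : R[i]^o).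
Local Notation normc := (@Normc.normc R).

Lemma partial_sumE (V : zmodType) (x : I -> V) (A : {fset I}) :
  summability.partial_sum x A = \sum_(i <- A) x i.
Proof. by rewrite /summability.partial_sum big_seq_fsetE. Qed.

Lemma cvg_partial_sumP x l : summability.partial_sum x @ summability.totally --> l <->
  forall e : R, 0 < e -> exists A : {fset I}, forall B : {fset I}, (A `<=` B)%fset ->
    normc (l - \sum_(i <- B) x i) < e.
Proof.
split=> [/cvgrPdist_lt xl e e0|xl].
  have [|A _ Ae] := xl e%:C; first by rewrite ltcR.
  exists A => B AB; have := Ae B AB.
  by rewrite /= partial_sumE -ltcR.
(* A positive element of [R[i]] has zero imaginary part, so the complex tolerance is a real one. *)
apply/cvgrPdist_lt => e; case: e => e e'; rewrite ltcE/= => /andP[/eqP -> e0].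
have [A Ae] := xl e e0; exists A => // B AB /=.
by rewrite partial_sumE [ltLHS]/(_%:C) ltcR; exact: Ae.
Qed.

Lemma normc_le_ReIm (z : R[i]) : normc z <= `|complex.Re z| + `|complex.Im z|.
Proof.
case: z => a b /=.
rewrite -[leRHS]ger0_norm ?addr_ge0// -sqrtr_sqr ler_wsqrtr//.
by rewrite sqrrD !real_normK ?num_real// addrAC lerDl mulrn_wge0 ?mulr_ge0.
Qed.

Lemma ReIm_le_normc (z : R[i]) : `|complex.Re z| <= normc z /\ `|complex.Im z| <= normc z.
Proof.
by case: z => a b /=; rewrite -!sqrtr_sqr; split;
  rewrite ler_wsqrtr// ?lerDl ?lerDr ?sqr_ge0.
Qed.

(** The limit is the supremum of the finite sums, which grow with the index set. *)
Lemma bounded_sum_approx (h : I -> R) (M : R) : (forall i, 0 <= h i) ->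
  (forall A : {fset I}, \sum_(i <- A) h i <= M) ->
  exists l : R, forall e, 0 < e -> exists A : {fset I}, forall B : {fset I}, (A `<=` B)%fset ->
    `|l - \sum_(i <- B) h i| < e.
Proof.
move=> h0 hM; set E := range (fun A : {fset I} => \sum_(i <- A) h i).
have supE : has_sup E.
  by split; [exists (\sum_(i <- fset0) h i), fset0|exists M => _ [A _ <-]].
exists (sup E) => e e0; have [_ [A _ <-] Ae] := sup_adherent e0 supE.
exists A => B AB; rewrite ger0_norm ?subr_ge0; last first.
  by apply: ub_le_sup; [case: supE|exists B].
by rewrite ltrBlDr -ltrBlDl; apply: lt_le_trans Ae _; exact: ler_sum_fset.
Qed.

(* Each real part is the difference of the two nonnegative families
   |z| + Re z and |z|, and likewise for imaginary parts. *)
Lemma bounded_unordered_summable x (M : R) :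
  (forall A : {fset I}, \sum_(i <- A) normc (x i) <= M) -> unordered_summable x.
Proof.
move=> xM; have n0 i := normc_ge0 (x i).
have bound (u : R[i] -> R) : (forall z, `|u z| <= normc z) ->
  exists l : R, forall e, 0 < e -> exists A : {fset I}, forall B : {fset I}, (A `<=` B)%fset ->
    `|l - \sum_(i <- B) u (x i)| < e.
  move=> un; have [l1 H1] := bounded_sum_approx n0 xM.
  have [||l2 H2] := @bounded_sum_approx (fun i => normc (x i) + u (x i)) (2 * M).
  - by move=> i; have := un (x i); rewrite ler_norml => /andP[]; lra.
  - move=> A; rewrite mulrC; apply: (@le_trans _ _ (\sum_(i <- A) normc (x i) * 2)).
      apply: ler_sum => i _; have := un (x i); rewrite ler_norml => /andP[_].
      by rewrite mulr_natr mulr2n lerD2l.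
    by rewrite -mulr_suml ler_pM2r.
  exists (l2 - l1) => e e0; have e2 : 0 < e / 2 by rewrite divr_gt0.
  have [A1 {}H1] := H1 _ e2; have [A2 {}H2] := H2 _ e2.
  exists (A1 `|` A2)%fset => B; rewrite fsubUset => /andP[/H1 {}H1 /H2].
  rewrite big_split/= => {}H2.
  have -> : l2 - l1 - \sum_(i <- B) u (x i) =
    (l2 - (\sum_(i <- B) normc (x i) + \sum_(i <- B) u (x i))) -
    (l1 - \sum_(i <- B) normc (x i)) by ring.
  by apply: le_lt_trans (ler_normB _ _) _; rewrite [ltRHS](splitr e) ltrD.
have [a Ha] := bound (@complex.Re R) (fun z => (ReIm_le_normc z).1).
have [b Hb] := bound (@complex.Im R) (fun z => (ReIm_le_normc z).2).
apply/cvg_ex; exists (a +i* b); apply/cvg_partial_sumP => e e0.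
have e2 : 0 < e / 2 by rewrite divr_gt0.
have [A1 {}Ha] := Ha _ e2; have [A2 {}Hb] := Hb _ e2.
exists (A1 `|` A2)%fset => B; rewrite fsubUset => /andP[/Ha {}Ha /Hb {}Hb].
apply: le_lt_trans (normc_le_ReIm _) _.
by rewrite [ltRHS](splitr e) !raddfB !raddf_sum !sumrN/=; exact: ltrD.
Qed.

Lemma normc_limit_le x l (M : R) :
  summability.partial_sum x @ summability.totally --> l ->
  (forall A : {fset I}, \sum_(i <- A) normc (x i) <= M) -> normc l <= M.
Proof.
move=> /cvg_partial_sumP xl xM; apply/ler_addgt0Pr => e /xl[A /(_ A (fsubset_refl _)) Ae].
rewrite -[l](subrK (\sum_(i <- A) x i)) addrC.
apply: le_trans (le_normcD _ _) _; rewrite lerD// ?(ltW Ae)//.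
exact: le_trans (normc_sum_le _ _ _) (xM A).
Qed.

(** Enlarging [A] only increases the sum. The limit [l] is a complex number, so the comparison is
    made on real parts. *)
Lemma sum_le_normc_limit (h : I -> R) l (A : {fset I}) : (forall i, 0 <= h i) ->
  summability.partial_sum (fun i => (h i)%:C : R[i]^o) @ summability.totally --> l ->
  \sum_(i <- A) h i <= normc l.
Proof.
move=> h0 /cvg_partial_sumP hl; apply/ler_addgt0Pr => e /hl[B].
move=> /(_ (A `|` B)%fset (fsubsetUr _ _)) Be.
apply: le_trans (ler_sum_fset h0 (fsubsetUl A B)) _.
rewrite -rmorph_sum/= in Be.
have [+ _] := ReIm_le_normc (l - (\sum_(i <- (A `|` B)%fset) h i)%:C).
have [+ _] := ReIm_le_normc l.
rewrite raddfB/= !ler_norml => /andP[_ h1] /andP[h2 _].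
by move: h1 h2 Be; lra.
Qed.

End complex_unordered_sums.

(** * From matrices to the scalar inequality *)

Section trace_duality.
Variables (R : realType) (d : nat).
Implicit Types S T : dyadic -> 'M[R[i]]_d.
Local Notation normc := (@Normc.normc R).

(** The squared norm of a row is a diagonal entry of the Gram matrix, hence readable from the sums
    that define [Tsqnorm]. *)
Definition row_sqnorm (A : 'M[R[i]]_d) (k : 'I_d) : R := \sum_l normc (A k l) ^+ 2.

Definition hs_norm (A : 'M[R[i]]_d) : R := Num.sqrt (\sum_k row_sqnorm A k).

Lemma row_sqnorm_ge0 (A : 'M[R[i]]_d) k : 0 <= row_sqnorm A k.
Proof. by apply: sumr_ge0 => l _; exact: sqr_ge0. Qed.

Lemma sqr_hs_norm (A : 'M[R[i]]_d) : hs_norm A ^+ 2 = \sum_k row_sqnorm A k.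
Proof. by rewrite sqr_sqrtr// sumr_ge0// => k _; exact: row_sqnorm_ge0. Qed.

Lemma le_hs_norm (A : 'M[R[i]]_d) k l : normc (A k l) <= hs_norm A.
Proof.
rewrite -[leLHS](ger0_norm (normc_ge0 _)) -sqrtr_sqr ler_wsqrtr//.
rewrite (bigD1 k)//= /row_sqnorm (bigD1 l)//= -addrA lerDl addr_ge0 ?sumr_ge0//.
  by move=> m _; exact: sqr_ge0.
by move=> m _; exact: row_sqnorm_ge0.
Qed.

Lemma gram_diag (A : 'M[R[i]]_d) k : (A *m A^t*%sesqui) k k = (row_sqnorm A k)%:C.
Proof.
rewrite mxE rmorph_sum; apply: eq_bigr => l _.
by rewrite !mxE -normCK rmorphXn.
Qed.

Lemma Tsqnorm_ge0 T : (0 <= Tsqnorm T)%E.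
Proof.
apply: le_trans (ereal_sup_ubound _); last by exists (0, 0).
by rewrite lee_fin opnorm_ge0.
Qed.

Lemma Tsqnorm_fin_num T : Tspace T -> Tsqnorm T \is a fin_num.
Proof. by move=> [_ Tfin]; rewrite ge0_fin_numE// Tsqnorm_ge0. Qed.

(** The squared Hilbert-Schmidt norm is the trace of the Gram matrix. Each of the d diagonal entries
    of the Gram sum is at most its operator norm, whence the factor d; nonnegativity allows finite
    subfamilies. *)
Lemma carleson_hs_norm T (F : {fset dyadic}) (J : dyadic) : Tspace T ->
  \sum_(I <- F | I \in dyadic_sub R J) hs_norm (T I) ^+ 2 <=
  d%:R * fine (Tsqnorm T) * dyadic_length R J.
Proof.
move=> TT; have [/(_ J) sJ _] := TT; have lJ := dyadic_length_gt0 R J.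
set U := unordered_sum (gram_restr T J).
have diag k : \sum_(I <- F | I \in dyadic_sub R J) row_sqnorm (T I) k <= normc (U k k).
  rewrite big_mkcond/=; apply: sum_le_normc_limit.
    by move=> I; case: ifP => // _; exact: row_sqnorm_ge0.
  (* Taking an entry is continuous, so it commutes with the unordered matrix sum. *)
  rewrite (_ : summability.partial_sum _ =
      (fun M : 'M[R[i]]_d => M k k) \o summability.partial_sum (gram_restr T J)).
    by apply: continuous_cvg sJ; exact: coord_continuous.
  apply/funext => B; rewrite /= !partial_sumE summxE; apply: eq_bigr => I _.
  by rewrite /gram_restr /patch; case: ifP => _; rewrite ?gram_diag ?mxE.
have Uk k : normc (U k k) <= fine (Tsqnorm T) * dyadic_length R J.
  rewrite -ler_pdivrMr// mulrC.
  apply: (@le_trans _ _ (opnorm (((dyadic_length R J)^-1)%:C *: U))).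
    apply: le_trans (le_opnorm _ k k); rewrite mxE Normc.normcM.
    by rewrite -[leRHS]/(Num.sqrt _ * _) expr0n addr0 sqrtr_sqr ger0_norm// invr_ge0 ltW.
  rewrite -lee_fin fineK ?Tsqnorm_fin_num//.
  by apply: ereal_sup_ubound; exists J.
under eq_bigr do rewrite sqr_hs_norm.
rewrite exchange_big/= -mulrA -[X in X%:R * _](card_ord d) mulr_natl -sumr_const.
by apply: ler_sum => k _; exact: le_trans (diag k) (Uk k).
Qed.

(** The constant collects d^2 from the trace, 3/2 from the scalar inequality and sqrt d from N, as
    N^2 = d ||T||^2. It is uniform in [F], which gives both summability and the bound on the sum. *)
Lemma sum_trace_terms_le T S (F : {fset dyadic}) : Tspace T -> Sspace S ->
  \sum_(I <- F) normc (trace_terms T S I) <=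
  d%:R ^+ 2 * (3 / 2 * Num.sqrt d%:R) * Num.sqrt (fine (Tsqnorm T)) * fine (Snorm S).
Proof.
move=> TT SS; set N := Num.sqrt (d%:R * fine (Tsqnorm T)).
have N2 : N ^+ 2 = d%:R * fine (Tsqnorm T).
  by rewrite sqr_sqrtr// mulr_ge0// fine_ge0// Tsqnorm_ge0.
have NE : N = Num.sqrt d%:R * Num.sqrt (fine (Tsqnorm T)) by rewrite -sqrtrM.
have mS : measurable_fun [set: R] (square_function S) by case/integrableP: SS.
have Fu : uniq F by [].
have Q : \sum_(I <- F) sqrt_increment F
    (fun I => opnorm (S I) ^+ 2 / dyadic_length R I) I * dyadic_length R I <= fine (Snorm S).
  by rewrite -lee_fin fineK ?Snorm_fin_num//; exact: sum_sqrt_increment_Snorm.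
have main : \sum_(I <- F) opnorm (S I) * hs_norm (T I) <= 3 / 2 * N * fine (Snorm S).
  apply: le_trans (scalar_duality (s := fun I => opnorm (S I)) (t := fun I => hs_norm (T I))
    (N := N) Fu _ _ _) _.
  - by move=> I; exact: opnorm_ge0.
  - exact: sqrtr_ge0.
  - by move=> J; rewrite N2; exact: carleson_hs_norm.
  by apply: ler_wpM2l => //; rewrite mulr_ge0 ?sqrtr_ge0.
rewrite (_ : _ * fine _ = d%:R ^+ 2 * (3 / 2 * N * fine (Snorm S))); last by rewrite NE; ring.
apply: (@le_trans _ _ (d%:R ^+ 2 * \sum_(I <- F) opnorm (S I) * hs_norm (T I))).
  rewrite mulr_sumr; apply: ler_sum => I _; apply: normc_trace_le => k l.
  (* The adjoint swaps the indices, and conjugation preserves the modulus. *)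
  by rewrite !mxE; apply: le_trans (le_hs_norm (T I) l k); case: (T I l k) => a b /=; rewrite sqrrN.
by apply: ler_wpM2l => //; rewrite exprn_ge0.
Qed.

End trace_duality.

(** * Summability, linearity, continuity and the norm bound *)

Theorem theorem3p1 (R : realType) (d : nat) (d_gt0 : (0 < d)%N) :
  (forall T : dyadic -> 'M[R[i]]_d, Tspace T ->
    [/\ (forall S : dyadic -> 'M[R[i]]_d, Sspace S ->
           unordered_summable (trace_terms T S)),
        (forall (a : R[i]) (S1 S2 : dyadic -> 'M[R[i]]_d),
           Sspace S1 -> Sspace S2 ->
           Sspace (fun I => a *: S1 I + S2 I) /\
           trace_functional T (fun I => a *: S1 I + S2 I) =
             a * trace_functional T S1 + trace_functional T S2) &
        (forall S0 : dyadic -> 'M[R[i]]_d, Sspace S0 ->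
           forall eps : R, 0 < eps ->
           exists2 delta : R, 0 < delta &
             forall S : dyadic -> 'M[R[i]]_d, Sspace S ->
               (Snorm (fun I => S I - S0 I)%R < delta%:E)%E ->
               Normc.normc (trace_functional T S - trace_functional T S0)
                 < eps)]) /\
  (exists c : R,
    forall T : dyadic -> 'M[R[i]]_d, Tspace T ->
    forall S : dyadic -> 'M[R[i]]_d, Sspace S ->
      ((Normc.normc (trace_functional T S))%:E
         <= c%:E * Tnorm T * Snorm S)%E).
Proof.
set c : R := d%:R ^+ 2 * (3 / 2 * Num.sqrt d%:R).
have c0 : 0 <= c by rewrite mulr_ge0 ?exprn_ge0// mulr_ge0.
have summ (T S : dyadic -> 'M[R[i]]_d) : Tspace T -> Sspace S ->
    unordered_summable (trace_terms T S).
  by move=> TT SS; apply: bounded_unordered_summable => A; exact: sum_trace_terms_le.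
have bound (T S : dyadic -> 'M[R[i]]_d) : Tspace T -> Sspace S ->
    Normc.normc (trace_functional T S) <=
    c * Num.sqrt (fine (Tsqnorm T)) * fine (Snorm S).
  move=> TT SS; apply: (normc_limit_le (summ T S TT SS)) => A.
  exact: sum_trace_terms_le.
have lin (T : dyadic -> 'M[R[i]]_d) (a : R[i]) (S1 S2 : dyadic -> 'M[R[i]]_d) :
    Tspace T -> Sspace S1 -> Sspace S2 ->
    trace_functional T (fun I => a *: S1 I + S2 I) =
    a * trace_functional T S1 + trace_functional T S2.
  move=> TT SS1 SS2.
  (* Linearity holds for finite partial sums and passes to the limit, as both series converge. *)
  have E : summability.partial_sum (trace_terms T (fun I => a *: S1 I + S2 I)) =
      (a \*: summability.partial_sum (trace_terms T S1))
      + summability.partial_sum (trace_terms T S2).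
    apply/funext => B.
    rewrite [RHS]/(a *: summability.partial_sum _ B + summability.partial_sum _ B).
    rewrite !partial_sumE [RHS](_ : _ =
      \sum_(I <- B) (a * trace_terms T S1 I + trace_terms T S2 I)).
      by apply: eq_bigr => I _; rewrite /trace_terms mulmxDl mxtraceD -scalemxAl mxtraceZ.
    by rewrite big_split; congr (_ + _); exact: mulr_sumr.
  rewrite [LHS]/(lim _) E.
  apply: (@cvg_lim (R[i]^o)); first exact: norm_hausdorff.
  exact: (cvgD (cvgZr (k := a) (summ T S1 TT SS1)) (summ T S2 TT SS2)).
split; last first.
  exists c => T TT S SS; apply: le_trans
    (_ : (_ <= (c * Num.sqrt (fine (Tsqnorm T)) * fine (Snorm S))%:E)%E) _.
    by rewrite lee_fin; exact: bound.
  rewrite !EFinM fineK ?Snorm_fin_num//.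
  by rewrite /Tnorm -[X in sqrte X](fineK (Tsqnorm_fin_num TT)).
move=> T TT; split=> [S SS|a S1 S2 SS1 SS2|S0 SS0 e e0].
- exact: summ.
- by split; [exact: SspaceZD|exact: lin].
set N := c * Num.sqrt (fine (Tsqnorm T)).
have N0 : 0 <= N by rewrite mulr_ge0.
(* The summand 1 keeps the denominator positive when N = 0. *)
exists (e / (N + 1)); first by rewrite divr_gt0// ltr_wpDl.
(* The difference takes the form a S1 + S2, to which stability of [Sspace] and linearity apply. *)
move=> S SS; have -> : (fun I => S I - S0 I) = (fun I => -1 *: S0 I + S I).
  by apply/funext => I; rewrite scaleN1r addrC.
have SSB := SspaceZD (-1) SS0 SS.
move=> SB; have := bound T _ TT SSB; rewrite lin// mulN1r addrC => h.
apply: le_lt_trans h _; rewrite -/N.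
move: SB; rewrite -(fineK (Snorm_fin_num SSB)) lte_fin ltr_pdivlMr ?ltr_wpDl// => SB.
apply: le_lt_trans SB; rewrite /= mulrC; apply: ler_wpM2l; last by rewrite lerDl.
by apply: fine_ge0; exact: Lnorm_ge0.
Qed.
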